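(* Let $\mathcal{E}^c_t$ be the series of connected flows on rooted trees, and $\mathcal{E}^c$ its value at $t=0$. Let $\mathrm{Crls}=\sum_{n\ge0}\frac{\mathrm{Crl}_n}{n!}$, where $\mathrm{Crl}_n$ is the corolla with $n+1$ vertices (a root with $n$ leaves attached to it). Then $$\mathcal{E}^c_t=\frac{1}{1-t}\,\mathrm{Crls}\diamond(\bullet,\mathcal{E}^c_t-\mathcal{E}^c)+\frac{b}{t}\Big(\mathrm{Crls}\diamond(\bullet,\mathcal{E}^c_t-\mathcal{E}^c)-\bullet\Big).$$
   Context: A rooted tree $T$ is a finite tree with a distinguished vertex (the root), edges oriented towards the root; $w\to v$ means that $w$ is a child of $v$. $\bullet$ is the one-vertex rooted tree. A flow on $T$ of size $k$ is a set $O$ of $k$ vertices (outputs) and a function $m:V(T)\to\mathbb{N}$ vanishing on $O$ (inputs with multiplicity are the vertices with $m>0$) such that the rates $r(v)\in\mathbb{Z}$ determined by $r(v)=m(v)-[v\in O]+\sum_{w\to v}r(w)$ are all $\ge 0$. Here $r(v)$ is the rate of the edge going out of $v$; the exit rate is $r(\mathrm{root})$. A flow is connected if every edge has strictly positive rate, i.e. $r(v)\ge1$ for every non-root vertex $v$. Let $\mathcal{E}^c_{T,t}=\sum b^{\text{size}}t^{\text{exit rate}}\in\mathbb{Q}[b][[t]]$ over all connected flows on $T$ and $\mathcal{E}^c_t=\sum_T\mathcal{E}^c_{T,t}\,T/\mathrm{aut}(T)$, sum over isomorphism classes of rooted trees, $\mathrm{aut}(T)$ being the number of automorphisms of $T$.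 **Operation $\diamond$ (from the Pre-Lie operad).** If $S$ is a rooted tree with vertex set $\{1,\dots,m\}$ and root $1$, and $T_1,\dots,T_m$ are rooted trees, let $S(T_1,\dots,T_m)$ be the sum, over all ways to choose for each edge $i\to j$ of $S$ a vertex of $T_j$, of the rooted tree obtained from the disjoint union of the $T_i$ by joining, for each edge $i\to j$ of $S$, the root of $T_i$ to the chosen vertex of $T_j$; the root is that of $T_1$. This is extended multilinearly to formal series in each $T_i$. For series $t,u$ of rooted trees, $S\diamond(t,u)=S(t,u,\dots,u)$ ($t$ at the root, $u$ at all other vertices), extended linearly to series in $S$. *)

(* Defs.v *)
From HB Require Import structures.
From mathcomp Require Import all_boot all_order all_algebra.
From mathcomp Require Import perm generic_quotient fraction.
From mathcomp Require Import boolp classical_sets functions cardinality fsbigop.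

Set Implicit Arguments.
Unset Strict Implicit.
Unset Printing Implicit Defensive.

Import GRing.Theory Num.Theory.
Local Open Scope classical_set_scope.
Local Open Scope quotient_scope.
Local Open Scope ring_scope.

Record fps (R : Type) := Fps { fpscoef : nat -> R }.

Notation "f `_[ n ]" := (fpscoef f n) (at level 3, n at level 200,
  left associativity, format "f `_[ n ]").

Lemma fpsP (R : Type) (f g : fps R) : (forall n, f`_[n] = g`_[n]) <-> f = g.
Proof.
split=> [|->//]; case: f g => [f] [g] /= fg.
by congr Fps; apply: funext.
Qed.

HB.instance Definition _ (R : Type) := gen_eqMixin (fps R).
HB.instance Definition _ (R : Type) := gen_choiceMixin (fps R).

Section FpsZmod.
Variable R : zmodType.
Implicit Types f g h : fps R.

Definition fps0 : fps R := Fps (fun _ => 0).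
Definition fpsopp f : fps R := Fps (fun n => - f`_[n]).
Definition fpsadd f g : fps R := Fps (fun n => f`_[n] + g`_[n]).

Fact fpsaddA : associative fpsadd.
Proof. by move=> f g h; apply/fpsP => n; rewrite /= addrA. Qed.
Fact fpsaddC : commutative fpsadd.
Proof. by move=> f g; apply/fpsP => n; rewrite /= addrC. Qed.
Fact fpsadd0 : left_id fps0 fpsadd.
Proof. by move=> f; apply/fpsP => n; rewrite /= add0r. Qed.
Fact fpsaddN : left_inverse fps0 fpsopp fpsadd.
Proof. by move=> f; apply/fpsP => n; rewrite /= addNr. Qed.

HB.instance Definition _ :=
  GRing.isZmodule.Build (fps R) fpsaddA fpsaddC fpsadd0 fpsaddN.

End FpsZmod.

Section FpsRing.
Variable R : comNzRingType.
Implicit Types f g h : fps R.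

Definition fpsC (c : R) : fps R := Fps (fun n => if n == 0%N then c else 0).
Definition fpsX : fps R := Fps (fun n => (n == 1%N)%:R).
Definition fpsmul f g : fps R :=
  Fps (fun n => \sum_(i < n.+1) f`_[i] * g`_[n - i]).

Let trunc m f : {poly R} := \poly_(i < m) f`_[i].

Let coef_fpsmul m n f g : (n < m)%N ->
  (fpsmul f g)`_[n] = (trunc m f * trunc m g)`_n.
Proof.
move=> nm; rewrite coefM /=; apply: eq_bigr => i _.
rewrite !coef_poly (leq_ltn_trans (leq_subr _ _) nm).
by rewrite (leq_ltn_trans _ nm) // -ltnS ltn_ord.
Qed.

Let coef_truncM m n f p : (n < m)%N ->
  (trunc m f * p)`_n = \sum_(i < n.+1) f`_[i] * p`_(n - i).
Proof.
move=> nm; rewrite coefM /=; apply: eq_bigr => i _.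
by rewrite coef_poly (leq_ltn_trans _ nm) // -ltnS ltn_ord.
Qed.

Fact fpsmulC : commutative fpsmul.
Proof.
move=> f g; apply/fpsP => n.
by rewrite !(@coef_fpsmul n.+1) // mulrC.
Qed.

Let mul3 n f g h :
  (fpsmul f (fpsmul g h))`_[n]
  = (trunc n.+1 f * (trunc n.+1 g * trunc n.+1 h))`_n.
Proof.
rewrite coef_truncM //=; apply: eq_bigr => i _; congr (_ * _).
by rewrite -coef_fpsmul // ltnS leq_subr.
Qed.

Fact fpsmulA : associative fpsmul.
Proof.
move=> f g h; apply/fpsP => n.
by rewrite [fpsmul (fpsmul f g) h]fpsmulC !mul3 mulrA mulrC.
Qed.

Fact fpsmul1 : left_id (fpsC 1) fpsmul.
Proof.
move=> f; apply/fpsP => n /=.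
rewrite big_ord_recl /= mul1r subn0 big1 ?addr0 // => i _.
by rewrite mul0r.
Qed.

Fact fpsmulDl : left_distributive fpsmul (@fpsadd R).
Proof.
move=> f g h; apply/fpsP => n /=; rewrite -big_split /=.
by apply: eq_bigr => i _; rewrite mulrDl.
Qed.

Fact fps1_neq0 : fpsC 1 != 0 :> fps R.
Proof. by apply/eqP => /fpsP /(_ 0%N) /= /eqP; rewrite oner_eq0. Qed.

HB.instance Definition _ := GRing.Zmodule_isComNzRing.Build (fps R)
  fpsmulA fpsmulC fpsmul1 fpsmulDl fps1_neq0.

Lemma coef_fpsM f g n :
  (f * g)`_[n] = \sum_(i < n.+1) f`_[i] * g`_[n - i].
Proof. by []. Qed.

Definition fps_unit : {pred fps R} := fun f => `[< exists g, g * f = 1 >].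
Definition fps_inv f : fps R :=
  if pselect (exists g, g * f = 1) is left fV then projT1 (cid fV) else f.

Fact fps_mulV : {in fps_unit, left_inverse 1 fps_inv *%R}.
Proof.
move=> f /asboolP fV; rewrite /fps_inv.
by case: pselect => // fV'; case: (cid fV').
Qed.
Fact fps_unitP f g : g * f = 1 -> fps_unit f.
Proof. by move=> gf; apply/asboolP; exists g. Qed.
Fact fps_inv_out : {in [predC fps_unit], fps_inv =1 id}.
Proof.
move=> f; rewrite inE => /asboolPn fV; rewrite /fps_inv.
by case: pselect.
Qed.

HB.instance Definition _ := GRing.ComNzRing_hasMulInverse.Build (fps R)
  fps_mulV fps_unitP fps_inv_out.

End FpsRing.

Section FpsIdomain.
Variable R : idomainType.

Let fps_val (f : fps R) : f != 0 ->
  exists2 n, f`_[n] != 0 & forall i, (i < n)%N -> f`_[i] = 0.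
Proof.
move=> f0; have exf : exists n, f`_[n] != 0.
  apply: contrapT => nf; move/eqP: f0; apply; apply/fpsP => n /=.
  by apply/eqP; apply: contrapT => /negP fn; apply: nf; exists n.
case: (ex_minnP exf) => n fn nmin; exists n => // i lt_in.
by apply/eqP; apply: contraTT lt_in => /nmin; rewrite -leqNgt.
Qed.

Fact fps_idomain : GRing.integral_domain_axiom (fps R).
Proof.
move=> f g fg0; rewrite -[_ || _]negbK negb_or; apply/negP => /andP[].
move=> /fps_val[i fi ltf] /fps_val[j gj ltg].
move/fpsP: fg0 => /(_ (i + j)%N); rewrite coef_fpsM.
have lti : (i < (i + j).+1)%N by rewrite ltnS leq_addr.
rewrite (bigD1 (Ordinal lti)) //= addKn big1 ?addr0 => [|k].
  by move/eqP; rewrite mulf_eq0 (negPf fi) (negPf gj).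
rewrite -val_eqE /= neq_ltn => /orP[ltk|gtk]; first by rewrite ltf ?mul0r.
by rewrite ltg ?mulr0 // ltn_subLR ?ltn_add2r // -ltnS ltn_ord.
Qed.

HB.instance Definition _ :=
  GRing.ComUnitRing_isIntegral.Build (fps R) fps_idomain.

End FpsIdomain.

(* Edges go from each non-root vertex to its parent; by convention the root is
   its own parent, which does not count as an edge. *)
Definition is_rtree (V : finType) (T : V * {ffun V -> V}) :=
  (T.2 T.1 == T.1) && [forall v, fconnect T.2 v T.1].

Record rtree (V : finType) := RTree {
  rtree_val :> V * {ffun V -> V};
  _ : is_rtree rtree_val }.

HB.instance Definition _ (V : finType) := [isSub for @rtree_val V].
HB.instance Definition _ (V : finType) := [Finite of rtree V by <:].

Definition troot (V : finType) (T : rtree V) : V := T.1.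
Definition parent (V : finType) (T : rtree V) (v : V) : V := T.2 v.
Definition child (V : finType) (T : rtree V) (v w : V) :=
  (w != troot T) && (parent T w == v).

Lemma parent_root (V : finType) (T : rtree V) : parent T (troot T) = troot T.
Proof. by have /andP[/eqP] := valP T. Qed.

Lemma rtree_ind (V : finType) (T : rtree V) (P : V -> Prop) : P (troot T) ->
  (forall v, v != troot T -> P (parent T v) -> P v) -> forall v, P v.
Proof.
move=> Pr Pp v; have /andP[_ /forallP/(_ v)/iter_findex] := valP T.
move: (findex _ _ _) => n; elim: n v => [|n IHn] v; first by move=> /= ->.
rewrite iterSr => /IHn Pv.
by have [->//|vr] := eqVneq v (troot T); apply: Pp.
Qed.

Definition is_iso (V W : finType) (T : rtree V) (U : rtree W) (f : V -> W) :=
  [/\ bijective f, f (troot T) = troot U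
    & forall v, f (parent T v) = parent U (f v)].

Definition iso (V W : finType) (T : rtree V) (U : rtree W) : bool :=
  `[< exists f, is_iso T U f >].

Definition aut (V : finType) (T : rtree V) : nat :=
  #|[pred f : {perm V} | `[< is_iso T T f >] ]|.

Definition ltree := {n : nat & rtree 'I_n}.
Definition ltree_iso (T U : ltree) : bool := iso (tagged T) (tagged U).

Fact ltree_iso_refl : reflexive ltree_iso.
Proof. by move=> T; apply/asboolP; exists id; split=> //; exists id. Qed.

Fact iso_sym (V W : finType) (T : rtree V) (U : rtree W) : iso T U -> iso U T.
Proof.
move=> /asboolP[f [[g fK gK] fr fp]]; apply/asboolP; exists g; split.
- by exists f.
- by rewrite -fr fK.
- by move=> w; rewrite -{1}(gK w) -fp fK.
Qed.

Fact iso_trans (V W X : finType) (T : rtree V) (U : rtree W) (Z : rtree X) :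
  iso T U -> iso U Z -> iso T Z.
Proof.
move=> /asboolP[f [fb fr fp]] /asboolP[g [gb gr gp]].
apply/asboolP; exists (g \o f); split=> [||v] /=.
- exact: bij_comp.
- by rewrite fr gr.
- by rewrite fp gp.
Qed.

Fact ltree_iso_sym : symmetric ltree_iso.
Proof. by move=> T U; apply/idP/idP; apply: iso_sym. Qed.

Fact ltree_iso_trans : transitive ltree_iso.
Proof. by move=> U T Z; apply: iso_trans. Qed.

Canonical ltree_equiv :=
  EquivRel ltree_iso ltree_iso_refl ltree_iso_sym ltree_iso_trans.

Definition rtclass := {eq_quot ltree_iso}.
HB.instance Definition _ := Choice.on rtclass.
HB.instance Definition _ := EqQuotient.on rtclass.

Definition class_of n (T : rtree 'I_n) : rtclass :=
  \pi_rtclass (Tagged (fun n => rtree 'I_n) T).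

Definition nvertices (tau : rtclass) : nat := tag (repr tau).
Definition tree (tau : rtclass) : rtree 'I_(nvertices tau) := tagged (repr tau).

Lemma iso_card (V W : finType) (T : rtree V) (U : rtree W) :
  iso T U -> #|V| = #|W|.
Proof. by move=> /asboolP[f [fb _ _]]; exact: bij_eq_card fb. Qed.

Lemma nvertices_class_of n (T : rtree 'I_n) : nvertices (class_of T) = n.
Proof.
have := erefl (class_of T); rewrite -{1}[class_of T]reprK => /eqmodP.
by move=> /iso_card; rewrite !card_ord.
Qed.

Lemma class_of_tree tau : class_of (tree tau) = tau.
Proof.
rewrite -[RHS]reprK /class_of /tree; congr (\pi_rtclass _).
by rewrite /nvertices; case: (repr tau).
Qed.

Lemma nvertices_gt0 tau : (0 < nvertices tau)%N.
Proof. exact: leq_ltn_trans (ltn_ord (troot (tree tau))). Qed.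

Definition small_ltree n := {m : 'I_n.+1 & rtree 'I_m}.

Lemma small_ltreeP n tau : (nvertices tau <= n)%N ->
  exists x : small_ltree n, class_of (tagged x) = tau.
Proof.
move=> le_n; have lt_n : (nvertices tau < n.+1)%N by [].
by exists (Tagged (fun m : 'I_n.+1 => rtree 'I_m)
  (tree tau : rtree 'I_(Ordinal lt_n))); rewrite /= class_of_tree.
Qed.

Lemma finite_nvertices n : finite_set [set tau | (nvertices tau <= n)%N].
Proof.
apply: (@sub_finite_set _ _ (range (fun x : small_ltree n =>
  class_of (tagged x)))).
  by move=> tau /= /small_ltreeP[x <-]; exists x.
by apply: finite_image; exact: finite_finset.
Qed.

(* [graft g] joins the root of T i to the vertex g i of T (parent S i), for
   each non-root vertex i of S. *)
Section Graft.
Variables (V : finType) (S : rtree V) (W : V -> finType).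
Variable T : forall i, rtree (W i).

Definition grafting :=
  {dffun forall i : {i : V | i != troot S}, W (parent S (val i))}.

Definition graft_parent (g : grafting) (x : {i : V & W i}) : {i : V & W i} :=
  if tagged x != troot (T (tag x)) then
    Tagged W (parent (T (tag x)) (tagged x))
  else if insub (tag x) is Some i then Tagged W (g i) else x.

Definition graft_val (g : grafting) :=
  (Tagged W (troot (T (troot S))), [ffun x => graft_parent g x]).

Fact graft_proof (g : grafting) : is_rtree (graft_val g).
Proof.
rewrite /is_rtree /= ffunE; apply/andP; split.
  by rewrite /graft_parent /= eqxx /= insubF // eqxx.
set r := Tagged W _.
suff H i (x : W i) : fconnect [ffun x => graft_parent g x] (Tagged W x) r.
  by apply/forallP => -[i x]; apply: H.
elim/(@rtree_ind _ S): i x => [|i ir IHi] x.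
  elim/(@rtree_ind _ (T (troot S))): x => [|x xr IHx]; first exact: connect0.
  apply: connect_trans IHx; apply: connect1 => /=.
  by rewrite ffunE /graft_parent /= xr.
elim/(@rtree_ind _ (T i)): x => [|x xr IHx].
  apply: connect_trans (IHi (g (exist _ i ir))); apply: connect1 => /=.
  by rewrite ffunE /graft_parent /= eqxx /= (insubT (fun i => i != troot S) ir).
apply: connect_trans IHx; apply: connect1 => /=.
by rewrite ffunE /graft_parent /= xr.
Qed.

Definition graft (g : grafting) : rtree {i : V & W i} := RTree (graft_proof g).

End Graft.

(* A series sum_tau c_tau tau is its family of coefficients. *)
Definition tseries (R : Type) := rtclass -> R.

Section TreeSeries.
Variable R : comNzRingType.

(* Infinite sums of tree series are finitely supported sums at each
   coefficient: see finite_ngraft, finite_insertion and finite_corolla. *)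
Definition single (tau : rtclass) : tseries R := fun sigma => (sigma == tau)%:R.

(* The coefficient of tau in S(T_1, ..., T_m). *)
Definition ngraft (V : finType) (S : rtree V) (T : V -> rtclass)
    (tau : rtclass) : nat :=
  #|[pred g : grafting S (fun i => 'I_(nvertices (T i)))
    | iso (graft (fun i => tree (T i)) g) (tree tau)]|.

(* S(u_1, ..., u_m) for series u_i, by multilinearity. *)
Definition insertion (V : finType) (S : rtree V) (u : V -> tseries R) :
    tseries R := fun tau =>
  \sum_(T \in [set: {ffun V -> rtclass}])
    (\prod_i u i (T i)) * (ngraft S T tau)%:R.

Definition diamond (s t u : tseries R) : tseries R := fun tau =>
  \sum_(sigma \in [set: rtclass])
    s sigma * insertion (tree sigma)
      (fun i => if i == troot (tree sigma) then t else u) tau.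

Lemma ngraft_nvertices (V : finType) (S : rtree V) (T : V -> rtclass) tau :
  ngraft S T tau != 0%N -> (\sum_i nvertices (T i) = nvertices tau)%N.
Proof.
rewrite -lt0n => /card_gt0P[g /iso_card]; rewrite card_ord => <-.
rewrite card_tagged sumnE big_map big_enum.
by apply: eq_bigr => i _; rewrite card_ord.
Qed.

Lemma finite_ngraft (V : finType) (S : rtree V) tau :
  finite_set [set T : {ffun V -> rtclass} | ngraft S T tau != 0%N].
Proof.
pose f (T : {ffun V -> small_ltree (nvertices tau)}) : {ffun V -> rtclass} :=
  [ffun i => class_of (tagged (T i))].
apply: (@sub_finite_set _ _ (range f)); last first.
  by apply: finite_image; exact: finite_finset.
move=> T /= /ngraft_nvertices sumT.
have /fin_all_exists[x Tx] i :
    exists x : small_ltree (nvertices tau), class_of (tagged x) = T i.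
  by apply: small_ltreeP; rewrite -sumT (bigD1 i) //= leq_addr.
by exists [ffun i => x i] => //; apply/ffunP => i; rewrite !ffunE.
Qed.

Lemma finite_insertion
    (u : forall sigma, 'I_(nvertices sigma) -> tseries R) tau :
  finite_set [set sigma | insertion (tree sigma) (@u sigma) tau != 0].
Proof.
apply: sub_finite_set (finite_nvertices (nvertices tau)) => sigma /= nz.
have [T ng] : exists T, ngraft (tree sigma) T tau != 0%N.
  apply: contrapT => noT; move/eqP: nz; apply; apply: fsbig1 => T _.
  have [->|nT] := eqVneq (ngraft (tree sigma) T tau) 0%N.
    by rewrite mulr0.
  by case: noT; exists T.
rewrite -(ngraft_nvertices ng) -[leqLHS]card_ord -sum1_card.
by apply: leq_sum => i _; exact: nvertices_gt0.
Qed.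

End TreeSeries.

Fact corolla_proof n : is_rtree (ord0 : 'I_n.+1, [ffun=> ord0]).
Proof.
rewrite /is_rtree /= ffunE eqxx; apply/forallP => v.
by apply: connect1; rewrite /= ffunE.
Qed.

Definition corolla n : rtree 'I_n.+1 := RTree (corolla_proof n).

Definition dot : rtclass := class_of (corolla 0).

Definition Crls (F : fieldType) : tseries F := fun tau =>
  \sum_(n \in [set: nat]) (n`!%:R)^-1 * single F (class_of (corolla n)) tau.

Lemma finite_corolla tau : finite_set [set n | class_of (corolla n) = tau].
Proof.
apply: (@sub_finite_set _ _ [set (nvertices tau).-1]); last exact: finite_set1.
by move=> n /= <-; rewrite nvertices_class_of.
Qed.

Section Flows.
Variables (V : finType) (T : rtree V).

(* A pair (outputs, input multiplicities). *)
Definition flow_data := ({set V} * {ffun V -> nat})%type.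

(* r is determined by F: see rates_uniq. *)
Definition rates (F : flow_data) (r : V -> int) :=
  forall v, r v = (F.2 v)%:Z - (v \in F.1)%:Z + \sum_(w | child T v w) r w.

Definition is_flow (F : flow_data) (r : V -> int) :=
  [/\ forall v, v \in F.1 -> F.2 v = 0%N, rates F r & forall v, 0 <= r v].

Definition is_connected (r : V -> int) := forall v, v != troot T -> 1 <= r v.

Definition connected_flows (k : nat) : set flow_data :=
  [set F | exists r, [/\ is_flow F r, is_connected r & r (troot T) = k%:Z]].

Definition Ecflow : fps {poly rat} :=
  Fps (fun k => \sum_(F \in connected_flows k) ('X^#|F.1| : {poly rat})).

Lemma rates_uniq F r r' : rates F r -> rates F r' -> r =1 r'.
Proof.
move=> rF rF'.
have stop n : iter n (parent T) (troot T) = troot T.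
  by elim: n => //= n ->; exact: parent_root.
have /fin_all_exists[k kP] v : exists n, iter n (parent T) v = troot T.
  elim/(@rtree_ind _ T): v => [|v _ [n nP]]; first by exists 0%N.
  by exists n.+1; rewrite iterSr.
pose N := \max_v k v.
have topN v : iter N (parent T) v = troot T.
  by rewrite -(subnK (leq_bigmax v : (k v <= N)%N)) iterD kP stop.
move=> v0; apply/eqP; apply: contrapT => /negP nz0.
suff [v _ /(_ N (ltnSn N))] : exists2 v, r v != r' v &
    forall i, (i < N.+1)%N -> iter i (parent T) v != troot T.
  by rewrite topN eqxx.
elim: N.+1 => {N topN} [|n [v nz up]]; first by exists v0.
have [w /andP[wr /eqP pw] nzw] : exists2 w, child T v w & r w != r' w.
  apply: contrapT => now; move/eqP: nz; apply.
  rewrite rF rF'; congr (_ + _); apply: eq_bigr => w cw.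
  by apply/eqP; apply: contrapT => /negP nw; apply: now; exists w.
by exists w => // -[|i] // lt_i; rewrite iterSr pw up.
Qed.

Lemma exit_rate F r : rates F r ->
  r (troot T) = (\sum_v F.2 v)%:Z - #|F.1|%:Z.
Proof.
move=> rF; have -> : #|F.1| = (\sum_v (v \in F.1))%N.
  by rewrite -sum1_card big_mkcond.
rewrite !(big_morph Posz PoszD (erefl _)) -sumrB.
have -> : \sum_v ((F.2 v)%:Z - (v \in F.1)%:Z)
    = \sum_v (r v - \sum_(w | child T v w) r w).
  by apply: eq_bigr => v _; rewrite [in RHS]rF addrK.
rewrite sumrB.
rewrite [X in _ - X](_ : _ = \sum_(w | w != troot T) r w).
  by rewrite (bigD1 (troot T)) //= addrK.
by rewrite [RHS](partition_big (parent T) xpredT).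
Qed.

Lemma finite_connected_flows k : finite_set (connected_flows k).
Proof.
pose N := (k + #|V|)%N.
pose f (x : {set V} * {ffun V -> 'I_N.+1}) : flow_data :=
  (x.1, [ffun v => val (x.2 v)]).
apply: (@sub_finite_set _ _ (range f)); last first.
  by apply: finite_image; exact: finite_finset.
move=> [O m] /= [r [[_ rF _] _ rk]].
have mN v : (m v < N.+1)%N.
  have /eqP := exit_rate rF; rewrite rk eq_sym subr_eq -PoszD /= => /eqP[sm].
  rewrite ltnS /N; apply: (@leq_trans (k + #|O|)).
    by rewrite -sm (bigD1 v) //= leq_addr.
  by rewrite leq_add2l max_card.
exists (O, [ffun v => Ordinal (mN v)]) => //.
by congr pair; apply/ffunP => v; rewrite !ffunE.
Qed.

End Flows.

(* 1/(1-t) and b/t are taken in the field of fractions of Q[b][[t]]. *)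
Notation Kbt := {fraction (fps {poly rat})}.
Notation tofrac := (@FracField.tofrac (fps {poly rat})).

Definition bK : Kbt := tofrac (fpsC 'X).
Definition tK : Kbt := tofrac (fpsX _).

Definition Ect : tseries Kbt := fun tau =>
  tofrac (Ecflow (tree tau)) / (aut (tree tau))%:R.

Definition Ec : tseries Kbt := fun tau =>
  tofrac (fpsC (Ecflow (tree tau))`_[0]) / (aut (tree tau))%:R.

(* Main.v *)
From mathcomp Require Import all_boot all_order all_algebra.
From mathcomp Require Import perm generic_quotient fraction finmap ring.
From mathcomp Require Import boolp classical_sets functions cardinality fsbigop.
Require Import Defs.

(** Let [tau] be a rooted tree and [sigma_k], [k] in [K], the branches hanging
    from its root. The identity follows from two independent facts.

    Flows. A connected flow on [tau] amounts to a connected flow of positive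
    exit rate on each branch together with what happens at the root: either
    an input of arbitrary multiplicity [j], which adds [j] to the sum of the
    exit rates of the branches, or an output, which subtracts 1 and requires
    that sum to be positive. With [P] the product over [k] of
    [E(sigma_k) - E(sigma_k)(0)], this reads
      [E(tau) = P / (1 - t) + (b / t) (P - P(0))],
    and [P(0)] is 1 if [tau] is the one-vertex tree and 0 otherwise
    ([Ecflow_bplus]).

    Trees. For a family [u_s = d_s / aut(s)], the coefficient of [tau] in
    Crls composed with (dot, u) is [prod_k d(sigma_k) / aut(tau)]
    ([diamond_Crls]). Only the corolla with [n = #|K|] leaves contributes.
    Inserting a dot at its root and trees [T_1, ..., T_n] at its leaves gives
    the tree [B+(T_1, ..., T_n)] whose branches are the [T_i], so the question
    is to count the tuples of trees for which it is isomorphic to [tau].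
    Rather than counting them by multiplicities, count isomorphisms: an
    isomorphism between [B+(T)] and [B+(sigma)] is a bijection [phi] of the
    branches and an isomorphism from each [T_i] to [sigma_(phi i)]
    ([niso_bplus]), and two isomorphic trees have as many isomorphisms between
    them as automorphisms. Every factor [1 / aut(T_i)] cancels, each of the
    [n!] bijections contributes the same term, and [n!] cancels the coefficient
    of the corolla.

    Taking [d_s = E(s) - E(s)(0)] makes the product of the second fact the
    series [P] of the first, divided by [aut(tau)]. *)

Set Implicit Arguments.
Unset Strict Implicit.
Unset Printing Implicit Defensive.

Import GRing.Theory Num.Theory.
Local Open Scope classical_set_scope.
Local Open Scope ring_scope.

(** * Products of generating series *)

(** Distributivity for a family of summations whose index types all differ,
    as for the flows on the different branches of a tree. *)
Lemma prod_sum_fprod (R : comNzRingType) (I : finType) (T_ : I -> finType)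
    (F : forall i, T_ i -> R) :
  \prod_i \sum_(j : T_ i) F i j = \sum_(t : fprod T_) \prod_i F i (t i).
Proof.
pose P i : {ffun T_ i -> R} := [ffun j => F i j].
transitivity (\sum_(t : fprod T_) \prod_(i in I) P i (t i)); last first.
  by apply: eq_bigr => t _; apply: eq_bigr => i _; rewrite ffunE.
rewrite big_fprod.
transitivity (\prod_i \sum_(j in tagged_with T_ i) untag 0 (P i) j); last first.
  exact: bigA_distr_big_dep.
apply: eq_bigr => i _.
transitivity (\sum_(j : T_ i) P i j).
  by apply: eq_bigr => j _; rewrite ffunE.
exact: (big_tag (fun i => P i)).
Qed.

Section FpsProd.
Variable R : comNzRingType.
Implicit Types f g : fps R.

Lemma coef_fps_sum (I : Type) (r : seq I) (P : pred I) (F : I -> fps R) n :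
  (\sum_(i <- r | P i) F i)`_[n] = \sum_(i <- r | P i) (F i)`_[n].
Proof. exact: (big_morph (fun f => f`_[n]) (fun _ _ => erefl _) (erefl _)). Qed.

Definition fps_mono (c : R) d : fps R := Fps (fun m => if m == d then c else 0).

Lemma fps_monoM c d c' d' :
  fps_mono c d * fps_mono c' d' = fps_mono (c * c') (d + d').
Proof.
apply/fpsP => m; rewrite coef_fpsM /=.
have [->|ne] := eqVneq m (d + d')%N.
  have ltd : (d < (d + d').+1)%N by rewrite ltnS leq_addr.
  rewrite (bigD1 (Ordinal ltd)) //= !eqxx addKn eqxx big1 ?addr0 // => i.
  by rewrite -val_eqE /= => /negPf ->; rewrite mul0r.
apply: big1 => i _; case: eqP => [id|]; last by rewrite mul0r.
case: eqP => [mi|]; last by rewrite mulr0.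
by move/eqP: ne; case; rewrite -id -mi subnKC // -ltnS.
Qed.

Lemma fps_mono_prod (I : finType) (c : I -> R) (d : I -> nat) :
  \prod_i fps_mono (c i) (d i) = fps_mono (\prod_i c i) (\sum_i d i)%N.
Proof.
pose K (f : fps R) (a : R) (b : nat) := f = fps_mono a b.
apply: (big_ind3 K) => // f a b f' a' b' -> ->; exact: fps_monoM.
Qed.

Lemma eq_coef_fps_prod n (I : finType) (f g : I -> fps R) :
  (forall i m, (m <= n)%N -> (f i)`_[m] = (g i)`_[m]) ->
  (\prod_i f i)`_[n] = (\prod_i g i)`_[n].
Proof.
move=> fg.
pose K (a b : fps R) := forall m, (m <= n)%N -> a`_[m] = b`_[m].
suff: K (\prod_i f i) (\prod_i g i) by apply.
apply: (big_ind2 K) => // [a b a' b' Ka Kb m le_m|i _]; last exact: fg.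
rewrite !coef_fpsM; apply: eq_bigr => i _; rewrite Ka ?Kb //.
  exact: leq_trans (leq_subr _ _) le_m.
by apply: leq_trans le_m; rewrite -ltnS.
Qed.

(** The sets of flows are infinite, but finite in each degree [d], which is
    why the coefficients are sums over level sets. *)
Definition genfun (U : choiceType) (X : set U) (d : U -> nat) (w : U -> R) :
  fps R := Fps (fun n => \sum_(x \in X `&` [set x | d x = n]) w x).

(** The elements of degree more than [n] do not affect the coefficient of
    degree [n]. Discarding them leaves finitely many monomials in each factor,
    and distributivity applies. *)
Lemma coef_genfun_prod (K : finType) (U : K -> choiceType)
    (X : forall k, set (U k)) (d : forall k, U k -> nat)
    (w : forall k, U k -> R) n :
  (forall k, finite_set (X k `&` [set x | (d k x <= n)%N])) ->
  (\prod_k genfun (X k) (d k) (w k))`_[n] =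
  \sum_(f \in [set f : {dffun forall k, U k} |
      (forall k, X k (f k)) /\ (\sum_k d k (f k) = n)%N])
    \prod_k w k (f k).
Proof.
move=> finX.
pose S k : {fset U k} := fset_set (X k `&` [set x | (d k x <= n)%N]).
have inS k x : x \in S k -> X k x /\ (d k x <= n)%N.
  by rewrite in_fset_set // inE.
rewrite (@eq_coef_fps_prod n _ _
    (fun k => \sum_(x : S k) fps_mono (w k (val x)) (d k (val x)))); last first.
  move=> k m le_mn; rewrite coef_fps_sum /=.
  rewrite (_ : _ `&` _ = [set x | (x \in S k) && (d k x == m)]); last first.
    apply/seteqP; split=> x /=.
      move=> [Xx dx]; rewrite in_fset_set // dx eqxx andbT inE /=.
      by rewrite dx.
    by move=> /andP[/inS[? _] /eqP].
  rewrite -(bigfs _ (r := S k)) //; last first.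
    by move=> i /andP[iS _]; rewrite iS.
  rewrite big_seq_fsetE /= [LHS](eq_bigl (fun x : S k => d k (val x) == m)).
    by rewrite big_mkcond; apply: eq_bigr => x _; rewrite eq_sym.
  by move=> x /=; rewrite (valP x).
rewrite prod_sum_fprod coef_fps_sum.
pose h (t : fprod (fun k => S k)) : {dffun forall k, U k} :=
  [ffun k => val (t k)].
rewrite (@reindex_fsbig _ _ _ _ _ h
    [set` [pred t | (\sum_k d k (val (t k)))%N == n]]).
  rewrite -(bigfs _ (r := index_enum _)) ?index_enum_uniq //; last first.
    by move=> t _; rewrite mem_index_enum.
  rewrite [RHS]big_mkcond; apply: eq_bigr => t _.
  rewrite fps_mono_prod /= eqnE eq_sym; case: eqP => // _.
  by apply: eq_bigr => k _; rewrite ffunE.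
split.
- move=> t /= /eqP <-; split=> [k|].
    by rewrite ffunE; case: (inS k _ (valP (t k))).
  by apply: eq_bigr => k _; rewrite ffunE.
- move=> t t' _ _ /ffunP tt'; apply/fprodP => k; apply: val_inj.
  by have := tt' k; rewrite !ffunE.
- move=> f /= [fX fn].
  have fS k : f k \in S k.
    rewrite in_fset_set // inE; split; first exact: fX.
    by rewrite -fn (bigD1 k) //= leq_addr.
  pose t : fprod (fun k => S k) := fprod_of_fun (fun k => FSetSub (fS k)).
  have tE k : val (t k) = f k by rewrite /t fprodE.
  exists t; last by apply/ffunP => k; rewrite ffunE tE.
  by rewrite /= -fn; apply/eqP; apply: eq_bigr => k _; rewrite tE.
Qed.
End FpsProd.

(** * Counting isomorphisms of rooted trees *)

Definition niso (V W : finType) (T : rtree V) (U : rtree W) : nat :=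
  #|[pred f : {ffun V -> W} | `[< is_iso T U f >]]|.

Lemma iso_refl (V : finType) (T : rtree V) : iso T T.
Proof. by apply/asboolP; exists id; split=> //; exists id. Qed.

Lemma is_iso_comp (V W X : finType) (T : rtree V) (U : rtree W) (Z : rtree X)
    (f : V -> W) (g : W -> X) :
  is_iso T U f -> is_iso U Z g -> is_iso T Z (g \o f).
Proof.
move=> [fb fr fp] [gb gr gp]; split=> [||v] /=.
- exact: bij_comp.
- by rewrite fr gr.
- by rewrite fp gp.
Qed.

Lemma is_iso_can (V W : finType) (T : rtree V) (U : rtree W) f g :
  cancel f g -> cancel g f -> is_iso T U f -> is_iso U T g.
Proof.
move=> fK gK [_ fr fp]; split; first by exists f.
- by rewrite -fr fK.
- by move=> w; rewrite -{1}(gK w) -fp fK.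
Qed.

Lemma niso_gt0 (V W : finType) (T : rtree V) (U : rtree W) :
  (0 < niso T U)%N = iso T U.
Proof.
apply/card_gt0P/asboolP => [[f]|[f fi]].
  by rewrite inE => fi; exists f.
exists [ffun v => f v]; rewrite inE.
by rewrite (_ : fun_of_fin _ = f) //; apply: funext => v; rewrite ffunE.
Qed.

(** [aut] counts permutations and [niso] counts functions on a finite type;
    using the same count for both lets automorphisms and isomorphisms between
    different trees be compared. *)
Lemma aut_niso (V : finType) (T : rtree V) : aut T = niso T T.
Proof.
pose h (s : {perm V}) : {ffun V -> V} := [ffun v => s v].
have hE s : h s = s :> (V -> V) by apply: funext => v; rewrite ffunE.
have h_inj : injective h.
  by move=> s s' ss'; apply/permP => v; rewrite -hE ss' hE.
rewrite /aut -(fintype.card_image h_inj); apply: eq_card => f; rewrite [RHS]inE.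
apply/fintype.imageP/idP => [[s]|].
  by rewrite inE => si ->; rewrite asboolE hE.
rewrite asboolE => fi.
have f_inj : injective f by case: fi => /bij_inj.
have fE : f = h (perm f_inj) by apply/ffunP => v; rewrite ffunE permE.
by exists (perm f_inj) => //; rewrite inE -hE -fE.
Qed.

(** Composition with a fixed isomorphism is a bijection between the two sets
    of isomorphisms. *)
Lemma niso_isol (V V' W : finType) (T : rtree V) (T' : rtree V') (U : rtree W) :
  iso T T' -> niso T U = niso T' U.
Proof.
move=> /asboolP[g gi]; have [[g' gK gK'] _ _] := gi.
pose h (f : {ffun V' -> W}) : {ffun V -> W} := [ffun v => f (g v)].
have hE f : h f = f \o g :> (V -> W) by apply: funext => v; rewrite ffunE.
have h_inj : injective h.
  move=> f f' /ffunP ff'; apply/ffunP => v.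
  by have := ff' (g' v); rewrite !ffunE gK'.
rewrite /niso -(fintype.card_image h_inj); apply: eq_card => f; rewrite [LHS]inE.
apply/idP/fintype.imageP => [|[f']].
  rewrite asboolE => fi.
  exists [ffun v => f (g' v)]; last first.
    by apply/ffunP => v; rewrite !ffunE gK.
  rewrite inE (_ : fun_of_fin _ = f \o g').
    exact: is_iso_comp (is_iso_can gK gK' gi) fi.
  by apply: funext => v; rewrite ffunE.
rewrite inE => f'i ->; rewrite asboolE hE.
exact: is_iso_comp gi f'i.
Qed.

Lemma niso_isor (V W W' : finType) (T : rtree V) (U : rtree W) (U' : rtree W') :
  iso U U' -> niso T U = niso T U'.
Proof.
move=> /asboolP[g gi]; have [[g' gK gK'] _ _] := gi.
pose h (f : {ffun V -> W}) : {ffun V -> W'} := [ffun v => g (f v)].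
have hE f : h f = g \o f :> (V -> W') by apply: funext => v; rewrite ffunE.
have h_inj : injective h.
  move=> f f' /ffunP ff'; apply/ffunP => v.
  by have := ff' v; rewrite !ffunE => /(can_inj gK).
rewrite /niso -(fintype.card_image h_inj); apply: eq_card => f; rewrite [RHS]inE.
apply/fintype.imageP/idP => [[f']|]; last rewrite asboolE => fi.
  rewrite inE => f'i ->; rewrite asboolE hE.
  exact: is_iso_comp f'i gi.
exists [ffun v => g' (f v)]; last by apply/ffunP => v; rewrite !ffunE gK'.
rewrite inE (_ : fun_of_fin _ = g' \o f).
  exact: is_iso_comp fi (is_iso_can gK gK' gi).
by apply: funext => v; rewrite ffunE.
Qed.

Lemma niso_autr (V W : finType) (T : rtree V) (U : rtree W) :
  niso T U = (iso T U * aut U)%N.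
Proof.
case isoTU: (iso T U); first by rewrite (niso_isol _ isoTU) aut_niso mul1n.
by apply/eqP; rewrite mul0n -leqn0 leqNgt niso_gt0 isoTU.
Qed.

Lemma aut_iso (V W : finType) (T : rtree V) (U : rtree W) :
  iso T U -> aut T = aut U.
Proof. by move=> i; rewrite !aut_niso (niso_isol _ i) (niso_isor _ i). Qed.

Lemma aut_gt0 (V : finType) (T : rtree V) : (0 < aut T)%N.
Proof. by rewrite aut_niso niso_gt0 iso_refl. Qed.

Lemma iso_tree (sigma tau : rtclass) :
  iso (tree sigma) (tree tau) = (sigma == tau).
Proof.
apply/idP/eqP => [st|->]; last exact: iso_refl.
by rewrite -(class_of_tree sigma) -(class_of_tree tau); apply/eqmodP.
Qed.

Lemma iso_tree_class_of n (T : rtree 'I_n) : iso (tree (class_of T)) T.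
Proof.
have /eqmodP := class_of_tree (class_of T); exact.
Qed.

Lemma tree_representative (V : finType) (T : rtree V) :
  exists sigma, iso T (tree sigma).
Proof.
pose U := (enum_rank (troot T),
  [ffun i : 'I_#|V| => enum_rank (parent T (enum_val i))]).
have UP : is_rtree U.
  rewrite /is_rtree /= ffunE enum_rankK parent_root eqxx /=.
  apply/forallP => i; rewrite -(enum_valK i); move: (enum_val i) => {}i.
  elim/(@rtree_ind _ T): i => [|v _ IHv]; first exact: connect0.
  apply: connect_trans IHv; apply: connect1.
  by rewrite /= ffunE enum_rankK.
exists (class_of (RTree UP)).
suff i : iso T (RTree UP) by apply: iso_trans i (iso_sym (iso_tree_class_of _)).
apply/asboolP; exists enum_rank; split=> [|//|v]; first exact: enum_rank_bij.
by rewrite {2}/parent /= ffunE enum_rankK.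
Qed.

(** * Trees from the family of their branches *)

Section BPlus.
Variables (K : finType) (W : K -> finType) (T : forall k, rtree (W k)).

Definition bplus_parent (v : option {k : K & W k}) : option {k : K & W k} :=
  if v is Some kx then
    if tagged kx == troot (T (tag kx)) then None
    else Some (Tagged W (parent (T (tag kx)) (tagged kx)))
  else None.

Definition bplus_val : option {k : K & W k} * {ffun _ -> option {k : K & W k}} :=
  (None, [ffun v => bplus_parent v]).

Fact bplus_proof : is_rtree bplus_val.
Proof.
rewrite /is_rtree /= ffunE eqxx /=; apply/forallP => -[[k x]|]; last exact: connect0.
elim/(@rtree_ind _ (T k)): x => [|x xr IHx].
  by apply: connect1; rewrite /= ffunE /= eqxx.
apply: connect_trans IHx; apply: connect1.
by rewrite /= ffunE /= (negPf xr).
Qed.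

(** The operator B+ of the algebra of rooted trees: [None] is a new root and
    the roots of the [T k] become its children. *)
Definition bplus : rtree (option {k : K & W k}) := RTree bplus_proof.

Lemma parent_bplus v : parent bplus v = bplus_parent v.
Proof. by rewrite /parent /= ffunE. Qed.

Lemma parent_bplus_root k : parent bplus (Some (Tagged W (troot (T k)))) = None.
Proof. by rewrite parent_bplus /= eqxx. Qed.

Lemma parent_bplus_nonroot k (x : W k) : x != troot (T k) ->
  parent bplus (Some (Tagged W x)) = Some (Tagged W (parent (T k) x)).
Proof. by move=> /negPf xr; rewrite parent_bplus /= xr. Qed.

End BPlus.

Lemma bijective_fin (V W : finType) (f : V -> W) :
  injective f -> (forall w, exists v, f v = w) -> bijective f.
Proof.
move=> f_inj /fin_all_exists[g gK]; exists g => // v.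
by apply: f_inj; rewrite gK.
Qed.

Lemma some_tagged_inj (K : finType) (W : K -> finType) k (x y : W k) :
  Some (Tagged W x) = Some (Tagged W y) -> x = y.
Proof. by move=> /Some_inj; exact: eq_from_Tagged. Qed.

Lemma some_tagged_tag (K : finType) (W : K -> finType) k k' (x : W k)
    (y : W k') :
  Some (Tagged W x) = Some (Tagged W y) -> k = k'.
Proof. by move=> /Some_inj /(congr1 tag). Qed.

Section BPlusMap.
Variables (K K' : finType) (W : K -> finType) (W' : K' -> finType).
Variables (T : forall k, rtree (W k)) (T' : forall k, rtree (W' k)).

Definition bplus_map (phi : K -> K') (f : forall k, W k -> W' (phi k))
    (v : option {k : K & W k}) : option {k : K' & W' k} :=
  omap (fun kx => Tagged W' (f (tag kx) (tagged kx))) v.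

Lemma is_iso_bplus_map (phi : K -> K') (f : forall k, W k -> W' (phi k)) :
  bijective phi -> (forall k, is_iso (T k) (T' (phi k)) (f k)) ->
  is_iso (bplus T) (bplus T') (bplus_map f).
Proof.
move=> [psi phiK psiK] fi; split=> //; last first.
  move=> [[k x]|]; last by rewrite !parent_bplus.
  have [fb fr fp] := fi k.
  rewrite !parent_bplus /= -fr (inj_eq (bij_inj fb)).
  by case: eqP => //= _; rewrite fp.
apply: bijective_fin => [[[k x]|] [[k' x']|] //= e|[[k y]|]]; last by exists None.
  have kk' : k = k' by apply: (can_inj phiK); exact: some_tagged_tag e.
  rewrite -{}kk' in x' e *; have [fb _ _] := fi k.
  by have /(bij_inj fb) -> := some_tagged_inj e.
rewrite -[k]psiK in y *; have [[g fK gK] _ _] := fi (psi k).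
by exists (Some (Tagged W (g y))); rewrite /= gK.
Qed.

(** An isomorphism permutes the children of the root, which defines [phi]; as
    the vertices of branch [k] are those whose path to the root goes through
    the child [k], it then sends branch [k] into branch [phi k]. *)
Lemma is_iso_bplusP (F : option {k : K & W k} -> option {k : K' & W' k}) :
  is_iso (bplus T) (bplus T') F ->
  exists phi : {ffun K -> K'}, exists f : forall k, {ffun W k -> W' (phi k)},
    [/\ bijective phi, forall k, is_iso (T k) (T' (phi k)) (f k)
      & F = bplus_map (fun k => f k)].
Proof.
move=> [Fb Fr Fp]; have F_inj := bij_inj Fb.
have FN : F None = None by [].
have /fin_all_exists[phi phiP] k :
    exists k', F (Some (Tagged W (troot (T k)))) =
               Some (Tagged W' (troot (T' k'))).
  have := Fp (Some (Tagged W (troot (T k)))).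
  rewrite parent_bplus_root FN parent_bplus.
  case E: (F _) => [[k' y]|]; last by move: E; rewrite -FN => /F_inj.
  by rewrite /=; case: eqP => // -> _; exists k'.
have FT k (x : W k) : exists y : W' (phi k),
    F (Some (Tagged W x)) = Some (Tagged W' y).
  elim/(@rtree_ind _ (T k)): x => [|x xr [y yP]]; first by exists (troot (T' (phi k))).
  have := Fp (Some (Tagged W x)); rewrite parent_bplus_nonroot // yP parent_bplus.
  case: (F _) => [[k' z]|] //=; case: eqP => // _ e.
  have kk' := some_tagged_tag e.
  by rewrite -{}kk' in z {e} *; exists z.
have /fin_all_exists[f fP] k : exists fk : {ffun W k -> W' (phi k)},
    forall x, F (Some (Tagged W x)) = Some (Tagged W' (fk x)).
  have /fin_all_exists[fk fkP] := FT k.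
  by exists [ffun x => fk x] => x; rewrite ffunE fkP.
have fr k : f k (troot (T k)) = troot (T' (phi k)).
  by have := phiP k; rewrite fP => /some_tagged_inj.
have phi_inj : injective phi.
  move=> k k' e; have := phiP k; rewrite e -phiP => /F_inj.
  exact: some_tagged_tag.
have Fsurj z : exists v, F v = z by have [G _ GK] := Fb; exists (G z).
(* Isomorphisms are counted with [phi] in a finite type. *)
pose phi' := [ffun k => phi k].
have phi'E : phi' = phi :> (K -> K') by apply: funext => k; rewrite ffunE.
rewrite -phi'E in f fP fr *; exists phi', f; split.
- rewrite phi'E; apply: bijective_fin => // k'.
  have [v] := Fsurj (Some (Tagged W' (troot (T' k')))).
  case: v => [[k x]|]; last by rewrite FN.
  by rewrite fP => /some_tagged_tag; rewrite phi'E => <-; exists k.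
- move=> k; split=> // [|x].
    apply: bijective_fin => [x x' e|y].
      have /F_inj : F (Some (Tagged W x)) = F (Some (Tagged W x')).
        by rewrite !fP e.
      exact: some_tagged_inj.
    have [v] := Fsurj (Some (Tagged W' y)).
    case: v => [[k' x]|]; last by rewrite FN.
    rewrite fP => e.
    have kk' : k' = k by apply: phi_inj; have := some_tagged_tag e; rewrite phi'E.
    by rewrite {}kk' in x e *; exists x; exact: some_tagged_inj e.
  have [->|xr] := eqVneq x (troot (T k)); first by rewrite parent_root !fr parent_root.
  have := Fp (Some (Tagged W x)); rewrite parent_bplus_nonroot // !fP.
  rewrite parent_bplus /=; case: eqP => // _.
  exact: some_tagged_inj.
- by apply: funext => -[[k x]|] //; rewrite fP.
Qed.

End BPlusMap.

(** The correspondence of branches is kept in the sum over [phi], so that no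
    grouping of isomorphic branches is needed. *)
Lemma niso_bplus (K K' : finType) (W : K -> finType) (W' : K' -> finType)
    (T : forall k, rtree (W k)) (T' : forall k, rtree (W' k)) :
  niso (bplus T) (bplus T') =
  (\sum_(phi : {ffun K -> K'} | `[< bijective phi >])
    \prod_k niso (T k) (T' (phi k)))%N.
Proof.
pose A := [pred phi : {ffun K -> K'} | `[< bijective phi >]].
pose Y (phi : {ffun K -> K'}) k :=
  {f : {ffun W k -> W' (phi k)} | `[< is_iso (T k) (T' (phi k)) f >]}.
pose P := {phi : {phi in A} & fprod (Y (val phi))}.
transitivity #|{: P}|; last first.
  rewrite card_tagged sumnE big_map big_enum /=.
  rewrite [RHS](big_sub A (fun phi => \prod_k niso (T k) (T' (phi k))))%N.
  apply: eq_bigr => phi _; rewrite card_fprod.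
  by apply: eq_bigr => k _; rewrite card_sig.
pose H (p : P) : {ffun option {k : K & W k} -> option {k : K' & W' k}} :=
  [ffun v => bplus_map (fun k => val (tagged p k)) v].
have HE p : H p = bplus_map (fun k => val (tagged p k)) :> (_ -> _).
  by apply: funext => v; rewrite ffunE.
have H_inj : injective H.
  move=> [phi t] [phi' t'] /ffunP e.
  have {}e k x : Some (Tagged W' (val (t k) x)) = Some (Tagged W' (val (t' k) x)).
    by have := e (Some (Tagged W x)); rewrite !ffunE.
  have pp' : phi = phi'.
    apply: val_inj; apply/ffunP => k.
    exact: some_tagged_tag (e k (troot (T k))).
  case: _ / pp' in t' e *; congr Tagged; apply/fprodP => k.
  by apply: val_inj; apply/ffunP => x; exact: some_tagged_inj (e k x).
rewrite /niso -(fintype.card_image H_inj); apply: eq_card => F; rewrite [LHS]inE.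
apply/idP/fintype.imageP => [|[[phi t] _ ->]]; rewrite asboolE; last first.
  rewrite HE; apply: is_iso_bplus_map => [|k]; first exact/asboolP/(valP phi).
  exact/asboolP/(valP (t k)).
move=> /is_iso_bplusP[phi [f [phib fi FE]]].
have phiA : phi \in A by rewrite inE.
pose t : fprod (Y phi) := [fprod k => exist _ (f k) (asboolT (fi k)) : Y phi k].
exists (Tagged (fun phi => fprod (Y (val phi)))
  (t : fprod (Y (val (exist _ phi phiA))))) => //.
apply/ffunP => v; rewrite FE HE; case: v => [[k x]|] //=.
by rewrite fprodE.
Qed.

Lemma iso_bplus (K : finType) (W W' : K -> finType)
    (T : forall k, rtree (W k)) (T' : forall k, rtree (W' k)) :
  (forall k, iso (T k) (T' k)) -> iso (bplus T) (bplus T').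
Proof.
move=> i; have f k : {f | is_iso (T k) (T' k) f}.
  by apply: cid; have /asboolP := i k.
apply/asboolP; exists (bplus_map (phi := id) (fun k => sval (f k))).
by apply: is_iso_bplus_map => [|k]; [exists id | exact: svalP (f k)].
Qed.

(** * Every tree is determined by its branches *)

Section Subtree.
Variables (V : finType) (T : rtree V) (c : V).

(** A vertex counts among its own descendants. *)
Definition descendant := {v : V | fconnect (parent T) v c}.
Definition subtree_root : descendant := exist _ c (connect0 _ c).

Definition subtree_val : descendant * {ffun descendant -> descendant} :=
  (subtree_root, [ffun v => if val v == c then subtree_root
                            else insubd subtree_root (parent T (val v))]).

Lemma descendant_parent v : fconnect (parent T) v c -> v != c ->
  fconnect (parent T) (parent T v) c.
Proof.
move=> /iter_findex; case: (findex _ _ _) => [<- /[!eqxx]//|n].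
by rewrite iterSr => {2}<- _; exact: fconnect_iter.
Qed.

Fact subtree_proof : is_rtree subtree_val.
Proof.
rewrite /is_rtree /= ffunE !eqxx /=; apply/forallP => -[v vc].
have := iter_findex vc; move: (findex _ _ _) => n.
elim: n v vc => [|n IHn] v vc.
  by move=> /= e; rewrite (_ : exist _ v vc = subtree_root) //; exact: val_inj.
have [e _|ne] := eqVneq v c.
  by rewrite (_ : exist _ v vc = subtree_root) //; exact: val_inj.
rewrite iterSr => /(IHn _ (descendant_parent vc ne)).
apply: connect_trans; apply: connect1.
rewrite /= ffunE /= (negPf ne); apply/eqP/val_inj.
by rewrite val_insubd descendant_parent.
Qed.

Definition subtree : rtree descendant := RTree subtree_proof.

Lemma val_parent_subtree v : v != troot subtree ->
  val (parent subtree v) = parent T (val v).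
Proof.
move=> vr; have ne : val v != c by rewrite -val_eqE in vr.
rewrite /parent /= ffunE (negPf ne) val_insubd.
by rewrite (descendant_parent (valP v) ne).
Qed.

End Subtree.

Lemma child_ancestor (V : finType) (T : rtree V) v : v != troot T ->
  exists2 c, child T (troot T) c & fconnect (parent T) v c.
Proof.
elim/(@rtree_ind _ T): v => [|v vr IHv _]; first by rewrite eqxx.
have [e|/IHv[c Tc vc]] := eqVneq (parent T v) (troot T).
  by exists v; [rewrite /child vr e eqxx | exact: connect0].
by exists c => //; apply: connect_trans vc; exact: fconnect1.
Qed.

(** Two ancestors of the same vertex lie on one path to the root, and a child
    of the root has only the root strictly above it. *)
Lemma child_ancestor_uniq (V : finType) (T : rtree V) v c c' :
  child T (troot T) c -> child T (troot T) c' ->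
  fconnect (parent T) v c -> fconnect (parent T) v c' -> c = c'.
Proof.
have iter_root n : iter n (parent T) (troot T) = troot T.
  by elim: n => //= n ->; exact: parent_root.
move=> + + /iter_findex + /iter_findex; move: (findex _ _ _) (findex _ _ _) => j i.
wlog le_ij : i j c c' / (i <= j)%N => [wl Tc Tc' ic jc'|].
  have [le|lt] := leqP i j; first exact: wl le Tc Tc' ic jc'.
  by rewrite (wl j i c' c _ Tc' Tc jc' ic) // ltnW.
move=> /andP[_ /eqP cr] /andP[c'r _] ic.
rewrite -(subnK le_ij) iterD ic; case: (j - i)%N => // n.
by rewrite iterSr cr iter_root => e; rewrite e eqxx in c'r.
Qed.

(** Besides the root, each vertex lies below exactly one child of the root. The
    branches are replaced by the representatives of their classes, the form in
    which they appear as coefficients of series. *)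
Lemma bplus_decomposition (V : finType) (T : rtree V) :
  exists (K : finType) (sigma : K -> rtclass),
    iso T (bplus (fun k => tree (sigma k))).
Proof.
pose K := {c : V | child T (troot T) c}.
pose F (v : option {c : K & descendant T (val c)}) : V :=
  if v is Some cv then val (tagged cv) else troot T.
have /fin_all_exists[sigma sigmaP] (c : K) := tree_representative (subtree T (val c)).
exists K, sigma.
apply: (@iso_trans _ _ _ _ (bplus (fun c : K => subtree T (val c)))); last first.
  exact: iso_bplus.
have child_root (c : K) (x : descendant T (val c)) : val x <> troot T.
  move=> e; have := valP x; rewrite e => /iter_findex; move: (findex _ _ _) => n.
  have -> : iter n (parent T) (troot T) = troot T.
    by elim: n => //= n ->; exact: parent_root.
  by move=> rc; have /andP[/eqP cr _] := valP c; exact: cr (esym rc).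
apply: iso_sym; apply/asboolP; exists F; split=> [|//|[[c x]|]].
- apply: bijective_fin => [[[c x]|] [[c' x']|] //= e|v].
  + have cc' : c = c'.
      apply: val_inj; apply: (child_ancestor_uniq (valP c) (valP c') (valP x)).
      by rewrite (e : val x = val x'); exact: (valP x').
    by rewrite -{}cc' in x' e *; rewrite (val_inj e).
  + by case: (child_root _ _ e).
  + by case: (child_root _ _ (esym e)).
  + have [->|vr] := eqVneq v (troot T); first by exists None.
    have [c Tc vc] := child_ancestor vr.
    pose c' : K := exist _ c Tc.
    by exists (Some (Tagged (fun c : K => descendant T (val c))
      (exist _ v vc : descendant T (val c')))).
- rewrite parent_bplus /=; case: eqP => [->|/eqP xr].
    by have /andP[_ /eqP] := valP c.
  exact: val_parent_subtree.
- by rewrite parent_bplus /= parent_root.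
Qed.

(** All edges of [S] end at its root, into which a single vertex is inserted,
    so there is only one place to join the other trees: that vertex. *)
Lemma iso_graft_bplus (V : finType) (S : rtree V) (W : V -> finType)
    (T : forall i, rtree (W i)) (g : grafting S W) :
  (forall i, parent S i = troot S) -> #|W (troot S)| = 1%N ->
  iso (graft T g) (bplus (fun i : {i : V | i != troot S} => T (val i))).
Proof.
move=> Sr /eqP/fintype1P[w0 Ww0].
have W1 (x : W (troot S)) : x = troot (T (troot S)) by rewrite Ww0 [RHS]Ww0.
have W1_tag i (x : W i) : i = troot S ->
    Tagged W (troot (T (troot S))) = Tagged W x.
  by move=> ir; rewrite {}ir in x *; rewrite [in RHS](W1 x).
pose F (v : option {i : {i : V | i != troot S} & W (val i)}) : {i : V & W i} :=
  if v is Some kx then Tagged W (tagged kx) else Tagged W (troot (T (troot S))).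
apply: iso_sym; apply/asboolP; exists F; split=> [|//|].
  apply: bijective_fin => [[[k x]|] [[k' x']|] //= e|[i x]].
  - have kk' : k = k' by apply: val_inj; exact: (congr1 tag e).
    by rewrite -{}kk' in x' e *; rewrite (eq_from_Tagged e).
  - by have /eqP := valP k; case; exact: (congr1 tag e).
  - by have /eqP := valP k'; case; exact: (congr1 tag (esym e)).
  - have [ir|ir] := eqVneq i (troot S).
      by exists None; exact: W1_tag.
    by exists (Some (Tagged (fun i : {i : V | i != troot S} => W (val i))
      (x : W (val (exist _ i ir : {i : V | i != troot S}))))).
move=> [[k x]|]; rewrite parent_bplus [RHS]/parent /= ffunE /graft_parent /=.
  case: eqP => [->|/eqP xr]; rewrite ?eqxx /= ?xr //.
  rewrite (insubT (fun i => i != troot S) (valP k)) /=.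
  exact: W1_tag.
by rewrite eqxx /= insubF ?eqxx.
Qed.

(** * Connected flows on a tree and on its branches *)

Section FlowTransport.
Variables (V W : finType) (T : rtree V) (U : rtree W).

Definition transport_flow (g : W -> V) (F : flow_data V) : flow_data W :=
  (finset (fun w => g w \in F.1), [ffun w => F.2 (g w)]).

Lemma connected_flows_transport f g k F :
  cancel f g -> cancel g f -> is_iso T U f ->
  connected_flows T k F -> connected_flows U k (transport_flow g F).
Proof.
move=> fK gK fi; have [_ gr gp] := is_iso_can fK gK fi.
move=> [r [[FO rF r_ge0] rc rk]]; exists (r \o g); split.
- split=> [w|w|w] //=; first by rewrite inE ffunE => /FO.
  rewrite rF inE ffunE; congr (_ + _).
  rewrite (reindex g) /=; last by exists f => v _.
  apply: eq_bigl => w'; rewrite /child -gp -gr.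
  by rewrite !(can_eq gK).
- by move=> w wr; apply: rc; rewrite -gr (can_eq gK).
- by rewrite /= gr.
Qed.

Lemma card_transport_flow g F : bijective g ->
  #|(transport_flow g F).1| = #|F.1|.
Proof.
move=> [f gK fK]; rewrite -!sum1_card [RHS](reindex g) /=; last by exists f => v _.
by apply: eq_bigl => w; rewrite inE.
Qed.

End FlowTransport.

(** Needed because a series evaluates [Ecflow] at the representative of a
    class, and not at the tree B+ of the branches. *)
Lemma Ecflow_iso (V W : finType) (T : rtree V) (U : rtree W) :
  iso T U -> Ecflow T = Ecflow U.
Proof.
move=> /asboolP[f fi]; have [[g fK gK] _ _] := fi.
have gi := is_iso_can fK gK fi.
apply/fpsP => k /=; apply/esym.
rewrite (@reindex_fsbig _ _ _ _ _ (transport_flow g) (connected_flows T k)).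
  apply: eq_fsbigr => F _; rewrite card_transport_flow //.
  by exists f.
have transportK (V' W' : finType) (a : V' -> W') b : cancel a b ->
    cancel (transport_flow b) (transport_flow a).
  move=> aK [O m]; congr pair; first by apply/setP => v; rewrite !inE aK.
  by apply/ffunP => v; rewrite !ffunE /= aK.
split=> [F|F F' _ _|F].
- exact: connected_flows_transport.
- exact: (can_inj (transportK _ _ _ _ fK)).
- move=> FU; exists (transport_flow f F).
    exact: (connected_flows_transport gK fK gi).
  exact: transportK.
Qed.

Lemma sum_option (R : nmodType) (A : finType) (F : option A -> R) :
  \sum_v F v = F None + \sum_a F (Some a).
Proof.
rewrite (bigD1 None) //=; congr (_ + _).
rewrite (reindex_omap Some id) /=; last by case.
by apply: eq_bigl => a; rewrite eqxx.
Qed.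

Lemma sum_bplus (R : nmodType) (K : finType) (W : K -> finType)
    (F : option {k : K & W k} -> R) :
  \sum_v F v = F None + \sum_k \sum_x F (Some (Tagged W (x : W k))).
Proof.
rewrite sum_option; congr (_ + _).
rewrite (sig_big_dep xpredT (fun k => xpredT) (fun k x => F (Some (Tagged W x)))).
by apply: eq_bigr => -[].
Qed.

Section BPlusFlows.
Variables (K : finType) (W : K -> finType) (T : forall k, rtree (W k)).

Lemma sum_child_bplus_root (r : option {k : K & W k} -> int) :
  \sum_(v | child (bplus T) None v) r v
  = \sum_k r (Some (Tagged W (troot (T k)))).
Proof.
rewrite big_mkcond sum_bplus /child /= add0r; apply: eq_bigr => k _.
rewrite (bigD1 (troot (T k))) //= parent_bplus_root eqxx big1 ?addr0 // => x xr.
by rewrite parent_bplus_nonroot.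
Qed.

Lemma sum_child_bplus k (x : W k) (r : option {k : K & W k} -> int) :
  \sum_(v | child (bplus T) (Some (Tagged W x)) v) r v
  = \sum_(y | child (T k) x y) r (Some (Tagged W y)).
Proof.
rewrite big_mkcond sum_bplus /child /= add0r (bigD1 k) //= [X in _ + X]big1 ?addr0.
  rewrite [RHS]big_mkcond; apply: eq_bigr => y _.
  have [->|yr] := eqVneq y (troot (T k)); first by rewrite parent_bplus_root.
  rewrite parent_bplus_nonroot //; congr (if _ then _ else _).
  by apply/eqP/eqP => [/some_tagged_inj|->].
move=> k' kk'; apply: big1 => y _; case: ifP => // /eqP.
have [->|yr] := eqVneq y (troot (T k')); first by rewrite parent_bplus_root.
by rewrite parent_bplus_nonroot // => /some_tagged_tag /eqP; rewrite (negPf kk').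
Qed.

End BPlusFlows.

(** Global conservation expresses the exit rate by inputs and outputs only; the
    truncated subtraction is exact on flows ([connected_flows_exit]). *)
Definition exit_of (V : finType) (F : flow_data V) : nat :=
  (\sum_v F.2 v - #|F.1|)%N.

Lemma connected_flows_exit (V : finType) (T : rtree V) k F :
  connected_flows T k F -> exit_of F = k.
Proof.
move=> [r [[_ rF _] _ rk]]; have /eqP := exit_rate rF.
by rewrite rk eq_sym subr_eq -PoszD /exit_of => /eqP[->]; rewrite addnK.
Qed.

(** The flows allowed on a branch: the edge from its root must have positive
    rate. *)
Definition positive_flows (V : finType) (T : rtree V) : set (flow_data V) :=
  [set F | (0 < exit_of F)%N /\ connected_flows T (exit_of F) F].

Definition flow_weight (V : finType) (F : flow_data V) : {poly rat} := 'X^#|F.1|.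

Lemma positive_flows_genfun (V : finType) (T : rtree V) :
  Ecflow T - fpsC (Ecflow T)`_[0] =
  genfun (positive_flows T) (@exit_of V) (@flow_weight V).
Proof.
apply/fpsP => -[|n] /=.
  rewrite subrr fsbig1 // => F /= [[+ _] e]; by rewrite e.
rewrite subr0; apply: eq_fsbigl; apply/seteqP; split=> F /=.
  by move=> Fn; rewrite /positive_flows /= (connected_flows_exit Fn).
by move=> [[_ +] e]; rewrite e.
Qed.

Lemma finite_positive_flows (V : finType) (T : rtree V) n :
  finite_set (positive_flows T `&` [set F | (exit_of F <= n)%N]).
Proof.
apply: (@sub_finite_set _ _ (\bigcup_(k in `I_n.+1) connected_flows T k)).
  by move=> F [[_ FT] Fn]; exists (exit_of F).
apply: bigcup_finite; first exact: finite_II.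
by move=> k _; exact: finite_connected_flows.
Qed.

Section BPlusDecomposition.
Variables (K : finType) (W : K -> finType) (T : forall k, rtree (W k)).

Definition restrict_flow (F : flow_data (option {k : K & W k})) k :
    flow_data (W k) :=
  (finset (fun x => Some (Tagged W x) \in F.1),
   [ffun x => F.2 (Some (Tagged W x))]).

(** The rate of a non-root vertex depends only on the flow above it, so rates
    can be restricted to branches and glued from them; the last condition is
    conservation at the root, stated without subtraction. *)
Lemma connected_flows_bplus n F :
  connected_flows (bplus T) n F <->
  [/\ None \in F.1 -> F.2 None = 0%N,
      forall k, positive_flows (T k) (restrict_flow F k)
    & (F.2 None + \sum_k exit_of (restrict_flow F k) = n + (None \in F.1))%N].
Proof.
split=> [[r [[FO rF r_ge0] rc rn]]|[FO Fk Fn]].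
  have Fk k : exists2 e : nat, r (Some (Tagged W (troot (T k)))) = e%:Z &
      (0 < e)%N /\ connected_flows (T k) e (restrict_flow F k).
    have := rc (Some (Tagged W (troot (T k)))) isT.
    case E: (r _) => [e|//] e_gt0; exists e => //; split=> //.
    exists (fun x => r (Some (Tagged W x))); split=> // [|x _]; last exact: rc.
    split=> [x|x|//]; first by rewrite inE ffunE => /FO.
    by rewrite rF sum_child_bplus inE ffunE.
  split=> [|k|]; first exact: FO.
    have [e _ [e_gt0 Fe]] := Fk k.
    by rewrite /positive_flows /= (connected_flows_exit Fe).
  have := rF None; rewrite sum_child_bplus_root (_ : r None = n%:Z); last exact: rn.
  rewrite (eq_bigr (fun k => (exit_of (restrict_flow F k))%:Z)); last first.
    by move=> k _; have [e -> [_ Fe]] := Fk k; rewrite (connected_flows_exit Fe).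
  rewrite -(big_morph Posz PoszD (erefl _)) => /eqP.
  by rewrite addrAC eq_sym subr_eq -!PoszD => /eqP[].
have /fin_all_exists[r rP] k := (Fk k).2.
pose R (v : option {k : K & W k}) : int :=
  if v is Some kx then r (tag kx) (tagged kx) else n%:Z.
exists R; split=> //; last first.
  move=> [[k x]|] //= _; have [_ rc rk] := rP k.
  have [->|xr] := eqVneq x (troot (T k)); last exact: rc.
  by rewrite rk; have [] := Fk k.
split=> [[[k x]|]|[[k x]|]|[[k x]|]] //=.
- by have [[FkO _ _] _ _] := rP k; have := FkO x; rewrite inE ffunE.
- have [[_ rF _] _ _] := rP k.
  by rewrite sum_child_bplus /= rF inE ffunE.
- rewrite sum_child_bplus_root /=.
  rewrite (eq_bigr (fun k => (exit_of (restrict_flow F k))%:Z)); last first.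
    by move=> k _; have [_ _ ->] := rP k.
  rewrite -(big_morph Posz PoszD (erefl _)); apply/eqP.
  by rewrite addrAC eq_sym subr_eq -!PoszD Fn.
- by have [[_ _ r_ge0] _ _] := rP k.
Qed.

Definition glue_flow (o : bool) (j : nat) (f : {dffun forall k, flow_data (W k)}) :
    flow_data (option {k : K & W k}) :=
  (finset (fun v => if v is Some kx then tagged kx \in (f (tag kx)).1 else o),
   [ffun v => if v is Some kx then (f (tag kx)).2 (tagged kx) else j]).

Lemma glue_flowK o j f k : restrict_flow (glue_flow o j f) k = f k.
Proof.
rewrite [RHS]surjective_pairing; congr pair.
  by apply/setP => x; rewrite !inE.
by apply/ffunP => x; rewrite !ffunE.
Qed.

Lemma restrict_flowK (F : flow_data (option {k : K & W k})) :
  glue_flow (None \in F.1) (F.2 None) [ffun k => restrict_flow F k] = F.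
Proof.
rewrite [RHS]surjective_pairing; congr pair.
  by apply/setP => -[[k x]|]; rewrite !inE //= ffunE inE.
by apply/ffunP => -[[k x]|]; rewrite !ffunE //= ffunE.
Qed.

Lemma flow_weight_bplus (F : flow_data (option {k : K & W k})) :
  flow_weight F = 'X^(None \in F.1) * \prod_k flow_weight (restrict_flow F k).
Proof.
rewrite /flow_weight prodrXr -exprD; congr ('X^_).
have cardE (V : finType) (A : {set V}) : #|A| = (\sum_v (v \in A))%N.
  by rewrite -sum1_card big_mkcond.
rewrite cardE (sum_bplus (fun v => (v \in F.1) : nat)) /=.
congr (_ + _)%N; apply: eq_bigr => k _; rewrite cardE.
by apply: eq_bigr => x _; rewrite inE.
Qed.

End BPlusDecomposition.

Lemma fsum_le_level (R : zmodType) (U : choiceType) (X : set U) (d : U -> nat)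
    (w : U -> R) n :
  (forall i, finite_set (X `&` [set x | d x = i])) ->
  \sum_(x \in X `&` [set x | (d x <= n)%N]) w x
  = \sum_(i < n.+1) \sum_(x \in X `&` [set x | d x = i]) w x.
Proof.
move=> finX; have finXle m : finite_set (X `&` [set x | (d x <= m)%N]).
  apply: (@sub_finite_set _ _ (\bigcup_(i in `I_m.+1) (X `&` [set x | d x = i]))).
    by move=> x [Xx dx]; exists (d x).
  by apply: bigcup_finite => [|i _]; [exact: finite_II | exact: finX].
elim: n => [|n IHn].
  rewrite big_ord1; apply: eq_fsbigl; apply/seteqP.
  split=> x /= [Xx dx]; split=> //; last by rewrite dx.
  by apply/eqP; move: dx; rewrite leqn0.
rewrite big_ord_recr -IHn /= -fsbigU0 //; last first.
  by move=> x /= [[_ +] [_ e]]; rewrite e ltnn.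
apply: eq_fsbigl; apply/seteqP; split=> x /=.
  move=> [Xx]; rewrite leq_eqVlt => /orP[/eqP ->|lt]; first by right.
  by left; split.
by move=> [[Xx dx]|[Xx ->]]; split=> //; exact: leqW.
Qed.

Section EcflowBPlus.
Variables (K : finType) (W : K -> finType) (T : forall k, rtree (W k)).

Definition children_series : fps {poly rat} :=
  \prod_k (Ecflow (T k) - fpsC (Ecflow (T k))`_[0]).

Let X : set {dffun forall k, flow_data (W k)} :=
  [set f | forall k, positive_flows (T k) (f k)].
Let d (f : {dffun forall k, flow_data (W k)}) := (\sum_k exit_of (f k))%N.
Let w (f : {dffun forall k, flow_data (W k)}) := \prod_k flow_weight (f k).

Let coef_children i :
  children_series`_[i] = \sum_(f \in X `&` [set f | d f = i]) w f.
Proof.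
rewrite /children_series (eq_bigr _ (fun k _ => positive_flows_genfun (T k))).
rewrite coef_genfun_prod // => k; exact: finite_positive_flows.
Qed.

Let glue_connected (o : bool) j f n : X f -> (o -> j = 0%N) ->
  (j + d f = n + o)%N -> connected_flows (bplus T) n (glue_flow o j f).
Proof.
move=> Xf oj jn; apply/connected_flows_bplus; split.
- by rewrite inE ffunE.
- by move=> k; rewrite glue_flowK.
- rewrite inE ffunE -jn; congr (_ + _)%N; apply: eq_bigr => k _.
  by rewrite glue_flowK.
Qed.

Let finite_level i : finite_set (X `&` [set f | d f = i]).
Proof.
pose h (F : flow_data (option {k : K & W k})) : {dffun forall k, flow_data (W k)} :=
  [ffun k => restrict_flow F k].
apply: (@sub_finite_set _ _ (h @` connected_flows (bplus T) i)); last first.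
  exact/finite_image/finite_connected_flows.
move=> f [Xf fi]; exists (glue_flow false 0 f).
  by apply: glue_connected => //; rewrite addn0 add0n.
by apply/ffunP => k; rewrite ffunE glue_flowK.
Qed.

(** The sum comes from the flows without output at the root, where an input of
    multiplicity [n - i] completes branches of total rate [i]; the last term
    comes from those with an output there, where the branches carry [n + 1]. *)
Lemma coef_Ecflow_bplus n :
  (Ecflow (bplus T))`_[n] =
  \sum_(i < n.+1) children_series`_[i] + 'X * children_series`_[n.+1].
Proof.
have d_restrict (F : flow_data (option {k : K & W k})) :
    d [ffun k => restrict_flow F k] = (\sum_k exit_of (restrict_flow F k))%N.
  by apply: eq_bigr => k _; rewrite ffunE.
rewrite /= (fsbigID [set F : flow_data (option {k : K & W k}) | None \in F.1]);
  last exact: finite_connected_flows.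
rewrite /= addrC; congr (_ + _).
  (* No output at the root: the input there makes up the missing rate. *)
  under [RHS]eq_bigr do rewrite coef_children.
  rewrite -fsum_le_level //.
  rewrite (@reindex_fsbig _ _ _ _ _ (fun f => glue_flow false (n - d f) f)
    (X `&` [set f | (d f <= n)%N])).
    apply: eq_fsbigr => f _; rewrite -/(flow_weight _) flow_weight_bplus.
    rewrite inE mul1r; apply: eq_bigr => k _; rewrite glue_flowK //.
  split.
  - move=> f [Xf fn]; split; last by rewrite /= inE.
    by apply: glue_connected => //; rewrite addn0 subnK.
  - move=> f f' _ _ ff'; apply/ffunP => k.
    by rewrite -(glue_flowK false (n - d f) f) ff' glue_flowK.
  - move=> F [/connected_flows_bplus[FO Fk Fn] /= /negP F0].
    rewrite (negPf F0) addn0 -d_restrict in Fn.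
    exists [ffun k => restrict_flow F k]; last first.
      by rewrite -[RHS]restrict_flowK (negPf F0) -Fn addnK.
    split=> [k|/=]; first by rewrite ffunE.
    by rewrite -Fn leq_addl.
(* An output at the root, hence no input there. *)
rewrite coef_children mulr_fsumr.
rewrite (@reindex_fsbig _ _ _ _ _ (fun f => glue_flow true 0 f)
  (X `&` [set f | d f = n.+1])).
  apply: eq_fsbigr => f _; rewrite -/(flow_weight _) flow_weight_bplus.
  rewrite inE expr1; congr (_ * _); apply: eq_bigr => k _; rewrite glue_flowK //.
split.
- move=> f [Xf fn]; split; last by rewrite /= inE.
  by apply: glue_connected => //; rewrite fn addn1.
- move=> f f' _ _ ff'; apply/ffunP => k.
  by rewrite -(glue_flowK true 0 f) ff' glue_flowK.
- move=> F [/connected_flows_bplus[FO Fk Fn] /= F0].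
  rewrite F0 (FO F0) addn1 add0n -d_restrict in Fn.
  exists [ffun k => restrict_flow F k].
    by split=> [k|//]; rewrite ffunE.
  by rewrite -[RHS]restrict_flowK F0 (FO F0).
Qed.

(** Each factor has constant coefficient 0, so only the empty product
    survives. *)
Lemma coef0_children_series : children_series`_[0] = (#|K| == 0%N)%:R.
Proof.
have coef0M (f g : fps {poly rat}) : (f * g)`_[0] = f`_[0] * g`_[0].
  by rewrite coef_fpsM big_ord1.
rewrite /children_series.
rewrite (big_morph (fun f : fps {poly rat} => f`_[0]) coef0M (erefl _)) /=.
under eq_bigr do rewrite subrr.
by rewrite prodr_const -expr0n; congr (_ ^+ _); apply: eq_card.
Qed.

(** The functional equation with the denominators [t] and [1 - t] cleared. *)
Lemma Ecflow_bplus :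
  fpsX _ * (1 - fpsX _) * Ecflow (bplus T) =
  fpsX _ * children_series +
  fpsC 'X * (1 - fpsX _) * (children_series - (#|K| == 0%N)%:R).
Proof.
have coefX (f : fps {poly rat}) n :
    (fpsX _ * f)`_[n] = if n is m.+1 then f`_[m] else 0.
  rewrite coef_fpsM; case: n => [|n]; first by rewrite big_ord1 /= mul0r.
  rewrite big_ord_recl /= mul0r add0r big_ord_recl /= mul1r subn1 /=.
  by rewrite big1 ?addr0 // => i _; rewrite mul0r.
have coefC (c : {poly rat}) (f : fps {poly rat}) n :
    (fpsC c * f)`_[n] = c * f`_[n].
  rewrite coef_fpsM big_ord_recl /= subn0 big1 ?addr0 // => i _.
  by rewrite mul0r.
pose S : fps {poly rat} := Fps (fun n => \sum_(i < n.+1) children_series`_[i]).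
pose D : fps {poly rat} := Fps (fun n => children_series`_[n.+1]).
have ES : Ecflow (bplus T) = S + fpsC 'X * D.
  apply/fpsP => n; rewrite coef_Ecflow_bplus.
  by rewrite -[RHS]/(S`_[n] + (fpsC 'X * D)`_[n]) coefC.
have SX : (1 - fpsX _) * S = children_series.
  rewrite mulrBl mul1r; apply/fpsP => n.
  rewrite -[LHS]/(S`_[n] - (fpsX _ * S)`_[n]) coefX.
  case: n => [|n] /=; first by rewrite subr0 big_ord1.
  by rewrite [X in X - _]big_ord_recr /= addrAC subrr add0r.
have DX : fpsX _ * D = children_series - (#|K| == 0%N)%:R.
  apply/fpsP => n; rewrite coefX.
  rewrite -[RHS]/(children_series`_[n] - (_ : fps {poly rat})`_[n]).
  case: n => [|n] /=.
    by rewrite coef0_children_series; case: eqP; rewrite /= subrr.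
  by case: eqP; rewrite /= subr0.
rewrite ES -DX -[in RHS]SX; ring.
Qed.
End EcflowBPlus.

(** * Composition with the series of corollas *)

Lemma card_bij_ffun (J K : finType) :
  #|[pred phi : {ffun J -> K} | `[< bijective phi >]]|
  = if #|J| == #|K| then (#|K|)`! else 0%N.
Proof.
case: eqP => [JK|nJK]; last first.
  apply: eq_card0 => phi; rewrite [LHS]inE; apply/asboolPn => phib.
  exact/nJK/(bij_eq_card phib).
rewrite -[(#|K|)`!]ffactnn -{2}JK -card_inj_ffuns cardsE.
apply: eq_card => phi; rewrite [LHS]inE [RHS]inE.
apply/asboolP/injectiveP => [/bij_inj//|phi_inj].
by apply: inj_card_bij => //; rewrite JK.
Qed.

(** There is a single way of grafting, so the count is 0 or 1. *)
Lemma ngraft_depth1 (V : finType) (S : rtree V) (T : V -> rtclass) tau :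
  (forall i, parent S i = troot S) -> T (troot S) = dot ->
  ngraft S T tau =
  iso (bplus (fun j : {i : V | i != troot S} => tree (T (val j)))) (tree tau).
Proof.
move=> Sr Tr.
have W1 i : #|'I_(nvertices (T (parent S i)))| = 1%N.
  by rewrite Sr Tr card_ord nvertices_class_of.
have Wr : #|'I_(nvertices (T (troot S)))| = 1%N.
  by rewrite Tr card_ord nvertices_class_of.
have isoE (g : grafting S (fun i => 'I_(nvertices (T i)))) :=
  iso_graft_bplus (fun i => tree (T i)) g Sr Wr.
have isoE' (g : grafting S (fun i => 'I_(nvertices (T i)))) :
    iso (graft (fun i => tree (T i)) g) (tree tau) =
    iso (bplus (fun j : {i : V | i != troot S} => tree (T (val j)))) (tree tau).
  apply/idP/idP => gt; first exact: iso_trans (iso_sym (isoE g)) gt.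
  exact: iso_trans (isoE g) gt.
rewrite /ngraft; case tauB: (iso (bplus _) _); last first.
  by apply: eq_card0 => g; rewrite [LHS]inE isoE' tauB.
transitivity #|{: grafting S (fun i => 'I_(nvertices (T i)))}|.
  by apply: eq_card => g; rewrite [LHS]inE isoE' tauB.
by rewrite card_dep_ffun /image_mem; elim: (enum_mem _) => //= i s ->; rewrite W1.
Qed.

Section Diamond.
Variables (F : fieldType) (charF : [pchar F] =i pred0).
Variables (K : finType) (sigma : K -> rtclass) (tau : rtclass).
Hypothesis tauE : iso (tree tau) (bplus (fun k => tree (sigma k))).
Variable d : rtclass -> F.

Let u : tseries F := fun s => d s / (aut (tree s))%:R.
Let c : F := (\prod_k d (sigma k)) / (aut (tree tau))%:R.

Let aut_neq0 s : (aut (tree s))%:R != 0 :> F.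
Proof. by rewrite ((pcharf0P F).1 charF) -lt0n aut_gt0. Qed.

Section Depth1.
Variables (V : finType) (S : rtree V).
Hypothesis Sr : forall i, parent S i = troot S.
Let J : finType := {i : V | i != troot S}.

Let branches (phi : J -> K) : {ffun V -> rtclass} :=
  [ffun i => if insub i is Some j then sigma (phi j) else dot].

Let branches_eq (phi : J -> K) (T : {ffun V -> rtclass}) :
  (T == branches phi) =
  (T (troot S) == dot) && [forall j : J, T (val j) == sigma (phi j)].
Proof.
have phir : branches phi (troot S) = dot by rewrite ffunE insubF ?eqxx.
have phij j : branches phi (val j) = sigma (phi j) by rewrite ffunE valK.
apply/eqP/andP => [->|[/eqP Tr /forallP Tj]].
  by split; [rewrite phir | apply/forallP => j; rewrite phij].
apply/ffunP => i; have [->|ir] := eqVneq i (troot S); first by rewrite phir.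
by have /eqP := Tj (exist _ i ir); rewrite -phij.
Qed.

(** Replacing the truth value of [B+(T)] being isomorphic to [tau] by a number
    of isomorphisms divided by [aut tau] turns it into a sum over bijections of
    the branches, in which each [aut (T j)] cancels. *)
Let insertion_term (T : {ffun V -> rtclass}) :
  (\prod_i (if i == troot S then single F dot else u) (T i))
    * (ngraft S T tau)%:R
  = \sum_(phi : {ffun J -> K} | `[< bijective phi >]) (T == branches phi)%:R * c.
Proof.
under [RHS]eq_bigr do rewrite branches_eq.
rewrite (bigD1 (troot S)) //= eqxx /single.
case: eqP => [Tr|_]; last by rewrite !mul0r big1 // => phi _; rewrite mul0r.
rewrite mul1r ngraft_depth1 //.
set B := bplus _.
have ->: (iso B (tree tau))%:R
    = (niso B (bplus (fun k => tree (sigma k))))%:R / (aut (tree tau))%:R :> F.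
  rewrite -(niso_isor _ tauE) niso_autr natrM mulfK //.
rewrite niso_bplus natr_sum mulr_suml mulr_sumr; apply: eq_bigr => phi /asboolP phib.
rewrite /c !mulrA; congr (_ / _).
rewrite (big_sub [pred i | i != troot S] (fun i => _)).
rewrite natr_prod -big_split /=.
have -> : \prod_k d (sigma k) = \prod_(j : J) d (sigma (phi j)).
  by rewrite (reindex phi) //=; exact: onW_bij.
have -> : [forall j : J, T (val j) == sigma (phi j)]%:R
    = \prod_(j : J) (T (val j) == sigma (phi j))%:R :> F.
  case: forallP => [Tj|/existsNP[j /negP nTj]].
    by rewrite big1 // => j _; rewrite Tj.
  by rewrite (bigD1 j) //= (negPf nTj) mul0r.
rewrite -big_split; apply: eq_bigr => j _ /=.
rewrite (negPf (valP j)) niso_autr iso_tree.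
by case: eqP => [->|_]; rewrite ?mul1n ?mul1r ?divfK // mul0n mulr0 mul0r.
Qed.

(** Each bijection [phi] selects exactly one family of insertions, and all of
    them have the same weight [c]. *)
Lemma insertion_depth1 :
  insertion S (fun i => if i == troot S then single F dot else u) tau =
  if #|J| == #|K| then (#|K|)`!%:R * c else 0.
Proof.
rewrite /insertion; under eq_fsbigr do rewrite insertion_term.
pose A := [fset branches (phi : {ffun J -> K}) | phi in {ffun J -> K}]%fset.
have branchesA (phi : {ffun J -> K}) : branches phi \in A by apply/imfsetP; exists phi.
rewrite (@fsbigTE _ _ _ _ A); last first.
  move=> T TA; apply: big1 => phi _; case: eqP => [e|_]; last by rewrite mul0r.
  by move: TA; rewrite e branchesA.
rewrite exchange_big /= (eq_bigr (fun=> c)) => [|phi _]; last first.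
  rewrite (bigD1_seq _ (branchesA phi) (fset_uniq A)) /= eqxx mul1r big1 ?addr0 // => T.
  by move=> /negPf ->; rewrite mul0r.
rewrite big_const_seq iter_addr_0.
rewrite (_ : count _ _ = #|[pred phi : {ffun J -> K} | `[< bijective phi >]]|); last first.
  by rewrite cardE -size_filter /enum_mem.
by rewrite card_bij_ffun; case: ifP => _; rewrite ?mulr_natl.
Qed.
End Depth1.

(** The corolla with [#|K|] leaves is the only one whose leaves can be matched
    with the branches of [tau]; its coefficient cancels the number of such
    bijections. *)
Lemma diamond_Crls : diamond (Crls F) (single F dot) u tau = c.
Proof.
have corolla_inj m n : class_of (corolla m) = class_of (corolla n) -> m = n.
  by move=> /(congr1 nvertices); rewrite !nvertices_class_of => -[].
have CrlsE n : Crls F (class_of (corolla n)) = (n`!%:R)^-1.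
  rewrite /Crls -(@fsbig_widen _ _ _ _ [set n]) //; last first.
    move=> m /= [_ mn]; rewrite /single.
    by case: eqP => [/corolla_inj e|]; [case: mn | rewrite mulr0].
  by rewrite fsbig_set1 /single eqxx mulr1.
have ins n : insertion (tree (class_of (corolla n)))
    (fun i => if i == troot (tree (class_of (corolla n))) then single F dot
              else u) tau
    = if n == #|K| then (#|K|)`!%:R * c else 0.
  rewrite insertion_depth1.
    rewrite card_sig (@eq_card _ _ (predC1 (troot (tree (class_of (corolla n)))))) //.
    by rewrite cardC1 card_ord nvertices_class_of.
  move=> i; have /asboolP[f [fb fr fp]] := iso_tree_class_of (corolla n).
  by apply: (bij_inj fb); rewrite fp fr /parent /= ffunE.
rewrite /diamond.
rewrite -(@fsbig_widen _ _ _ _ [set class_of (corolla #|K|)]) //; last first.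
  move=> s /= [_ sK].
  have [[n sn]|ns] := pselect (exists n, s = class_of (corolla n)).
    rewrite sn ins; case: eqP => [nK|]; last by rewrite mulr0.
    by case: sK; rewrite sn nK.
  rewrite /Crls fsbig1 ?mul0r // => n _; rewrite /single.
  by case: eqP => [sn|]; [case: ns; exists n | rewrite mulr0].
rewrite fsbig_set1 CrlsE ins eqxx mulKf //.
by rewrite ((pcharf0P F).1 charF) -lt0n fact_gt0.
Qed.

End Diamond.

Lemma dot_bplus (K : finType) (sigma : K -> rtclass) tau :
  iso (tree tau) (bplus (fun k => tree (sigma k))) ->
  (tau == dot) = (#|K| == 0%N).
Proof.
move=> tauE; rewrite -iso_tree.
have dotE : iso (tree dot) (corolla 0) := iso_tree_class_of _.
apply/idP/eqP => [td|/card0_eq K0].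
  have := iso_card (iso_trans (iso_sym tauE) (iso_trans td dotE)).
  rewrite card_ord card_option card_tagged sumnE big_map big_enum /= => -[/eqP].
  rewrite sum_nat_eq0 => /forallP s0; apply: eq_card0 => k.
  have := s0 k; rewrite card_ord => /eqP s0k.
  by have := nvertices_gt0 (sigma k); rewrite s0k.
apply: iso_trans tauE (iso_trans _ (iso_sym dotE)).
apply/asboolP; exists (fun=> ord0); split=> // [|v].
  apply: bijective_fin => [[[k x]|] [[k' x']|] //|w].
  - by have := K0 k.
  - by have := K0 k.
  - by have := K0 k'.
  - by exists None; rewrite [w]ord1.
by rewrite [RHS]ord1.
Qed.

Lemma aut_dot : aut (tree dot) = 1%N.
Proof.
rewrite (aut_iso (iso_tree_class_of (corolla 0))).
apply/eqP; rewrite eqn_leq aut_gt0 andbT.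
by apply: leq_trans (max_card _) _; rewrite card_Sn.
Qed.

Lemma Kbt_pchar0 : [pchar Kbt] =i pred0.
Proof.
apply/pcharf0P => n; rewrite -(rmorph_nat tofrac) tofrac_eq0.
apply/idP/eqP => [/eqP/fpsP/(_ 0%N)|->]; last by rewrite mulr0n eqxx.
have -> : (n%:R : fps {poly rat})`_[0] = n%:R.
  by elim: n => // n IHn; rewrite [RHS]mulrS -IHn mulrS.
move=> /eqP; rewrite -polyC_natr polyC_eq0 pnatr_eq0 => /eqP; exact.
Qed.

Lemma divide_functional_equation (F : fieldType) (t b E P k a : F) :
  t != 0 -> 1 - t != 0 -> a != 0 ->
  t * (1 - t) * E = t * P + b * (1 - t) * (P - k) ->
  E / a = (1 - t)^-1 * (P / a) + b / t * (P / a - k / a).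
Proof.
move=> t0 t1 a0 eqE; apply: (mulfI t0); apply: (mulfI t1).
transitivity (t * (1 - t) * E / a); first by ring.
by rewrite eqE; field; rewrite t0 t1 a0.
Qed.

Theorem theorem3p3 (tau : rtclass) :
  let C : tseries Kbt :=
    diamond (Crls Kbt) (single Kbt dot) (fun sigma => Ect sigma - Ec sigma) in
  Ect tau = (1 - tK)^-1 * C tau + bK / tK * (C tau - single Kbt dot tau).
Proof.
have [K [sigma tauE]] := bplus_decomposition (tree tau).
pose d s := tofrac (Ecflow (tree s) - fpsC (Ecflow (tree s))`_[0]).
rewrite /= (_ : (fun s => _) = (fun s => d s / (aut (tree s))%:R)); last first.
  by apply: funext => s; rewrite /Ect /Ec -mulrBl /d rmorphB.
rewrite (diamond_Crls Kbt_pchar0 tauE).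
pose P := children_series (fun k => tree (sigma k)).
have -> : \prod_k d (sigma k) = tofrac P by rewrite rmorph_prod.
have single_dot : single Kbt dot tau
    = tofrac (#|K| == 0%N)%:R / (aut (tree tau))%:R.
  rewrite /single -(dot_bplus tauE); case: eqP => [->|_].
    by rewrite aut_dot rmorph1 divr1.
  by rewrite rmorph0 mul0r.
rewrite single_dot /Ect (Ecflow_iso tauE).
have t0 : tK != 0.
  by rewrite tofrac_eq0; apply/eqP => /fpsP/(_ 1%N)/eqP; rewrite /= oner_eq0.
have t1 : 1 - tK != 0.
  rewrite -(rmorph1 tofrac) -rmorphB tofrac_eq0.
  by apply/eqP => /fpsP/(_ 0%N)/eqP; rewrite /= subr0 oner_eq0.
have aut0 : (aut (tree tau))%:R != 0 :> Kbt.
  by rewrite ((pcharf0P _).1 Kbt_pchar0) -lt0n aut_gt0.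
have := congr1 tofrac (Ecflow_bplus (fun k => tree (sigma k))).
rewrite !(rmorphD, rmorphN, rmorphM, rmorph1) /= -/tK -/bK -/P => eqE.
exact: divide_functional_equation eqE.
Qed.
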